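(* Assume a linear reward function $r(s,a)=\langle w^*,\phi(s,a)\rangle$, where $w^*\in\mathbb{R}^d$ are unknown reward parameters with $\|w^*\|\le 1$, and perspectives characterized by linear transformations $\{A_\nu\}_{\nu\in\mathcal V}$, $A_\nu\in\mathbb{R}^{d_\nu\times d}$, of the features $\phi(s,a)$. Assume that the learner's policy $\pi^{L}$ matches the feature expectations of the expert's policy $\pi^{E}$ with precision $\epsilon/|\mathcal V|$ for all perspectives, i.e. $$\|A_\nu(\mu(\pi^{E})-\mu(\pi^{L}))\|<\frac{\epsilon}{|\mathcal V|}\quad\text{for all }\nu\in\mathcal V .$$ Then $$\bigl|\langle w^*,\mu(\pi^{E})-\mu(\pi^{L})\rangle\bigr|<\frac{\epsilon}{\sigma(\bar A)}+\rho(\bar A;w^* )\,\operatorname{diam}\mu(\Pi),$$ where $\bar A$ is the matrix resulting from stacking all transformation matrices $A_\nu$, $\nu\in\mathcal V$, on top of each other, $\sigma(\bar A)=\min_{v\perp\ker\bar A,\ \|v\|=1}\|\bar A v\|$, $\rho(\bar A;w^* )=\max_{v\in\ker\bar A,\ \|v\|=1}\langle w^*,v\rangle$, $\Pi$ is the set of possible learner policies, and $\operatorname{diam}\mu(\Pi)=\sup_{\pi_1,\pi_2\in\Pi}\|\mu(\pi_1)-\mu(\pi_2)\|$. Furthermore, if $\operatorname{rank}(\bar A)=d$, then identifying a policy $\pi^{L}$ which matches the feature expectations of the expert exactly in all perspectives (i.e. $A_\nu\mu(\pi^{L})=A_\nu\mu(\pi^{E})$ for all $\nu\in\mathcal V$)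 ensures that the learner matches the expert's performance, i.e. $$\bigl|\langle w^*,\mu(\pi^{E})-\mu(\pi^{L})\rangle\bigr|=0 .$$
   Context: Consider a Markov decision process with state set $\mathcal S$, action set $\mathcal A$, transition probabilities (giving for each $(s,a)$ a distribution over next states) and an initial state distribution. A (stochastic) policy $\pi$ is given by the probabilities $\pi(s,a)$ of taking action $a$ in state $s$. An expert follows a policy $\pi^{E}$ and a learner, who tries to imitate the expert, follows a policy $\pi^{L}$. Each state-action pair has a ground-truth feature vector $\phi(s,a)\in\mathbb{R}^d$. The learner can observe the expert from a finite set $\mathcal V$ of perspectives; in perspective $\nu\in\mathcal V$ the features seen are $\phi_\nu(s,a)=A_\nu\phi(s,a)$. With discount factor $\gamma$, the expected discounted features of a policy $\pi$ are $\mu(\pi)=\mathbb{E}\bigl[\sum_{t=0}^\infty\gamma^t\phi(s_t,a_t)\mid\pi\bigr]\in\mathbb{R}^d$. Here $\langle\cdot,\cdot\rangle$ is the standard inner product and $\|\cdot\|$ the Euclidean norm. If $\ker\bar A=\{0\}$, then $\rho(\bar A;w^* )$ is understood to be $0$.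
   Formalization: The expert's policy is assumed to belong to Π (with Π={π^L} the diameter is 0 and the bound can fail), and the first part assumes Ā≠0, since otherwise the minimum defining σ(Ā) is over an empty set. *)

(* Defs.v *)
(* MathComp / MathComp-Analysis *)
From HB Require Import structures.
From mathcomp Require Import all_boot all_order all_algebra.
From mathcomp Require Import all_classical all_reals all_analysis.

Set Implicit Arguments.
Unset Strict Implicit.
Unset Printing Implicit Defensive.

Import Order.TTheory GRing.Theory Num.Theory.
Import numFieldNormedType.Exports.

Local Open Scope classical_set_scope.
Local Open Scope ring_scope.

Section Euclidean.
Context {R : realType}.

Definition dot n (u v : 'cV[R]_n) : R := \sum_i u i 0 * v i 0.

(* The norm that the library puts on matrices is the sup norm, hence this
   separate Euclidean norm. *)
Definition enorm n (u : 'cV[R]_n) : R := Num.sqrt (dot u u).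

(* Extended-real valued, so that no boundedness of X is presupposed. *)
Definition ediam n (X : set 'cV[R]_n) : \bar R :=
  ereal_sup [set (enorm (x - y))%:E | x in X & y in X].

Definition ker m n (M : 'M[R]_(m, n)) : set 'cV[R]_n := [set v | M *m v = 0].

(* The infimum is a minimum, by compactness of the unit sphere, as soon as the
   set is nonempty, i.e. as soon as M != 0. *)
Definition sigma m n (M : 'M[R]_(m, n)) : R :=
  inf [set enorm (M *m v) |
        v in [set v | (forall u, ker M u -> dot u v = 0) /\ enorm v = 1]].

(* The supremum is a maximum, by compactness, in the second branch. *)
Definition rho m n (M : 'M[R]_(m, n)) (w : 'cV[R]_n) : R :=
  if `[< ker M = [set 0] >] then 0
  else sup [set dot w v | v in [set v | ker M v /\ enorm v = 1]].

(* The order of the blocks is that of the enumeration of V. *)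
Definition stack n (V : finType) (dV : V -> nat)
    (M : forall nu : V, 'M[R]_(dV nu, n)) :=
  \mxcol_(k < #|V|) M (enum_val k).

End Euclidean.

Section MDP.
Context {R : realType} {dO dS dA : measure_display}
  {Omega : measurableType dO} {S : measurableType dS} {A : measurableType dA}.
Implicit Types (s : nat -> {mfun Omega >-> S}) (a : nat -> {mfun Omega >-> A}).

(* The sigma-algebra generated by s_0, a_0, ..., s_(t-1), a_(t-1), s_t. *)
Definition state_history s a (t : nat) : set (set Omega) :=
  <<s [set E | (exists k B, [/\ (k <= t)%N, measurable B & E = s k @^-1` B]) \/
               (exists k C, [/\ (k < t)%N, measurable C & E = a k @^-1` C])] >>.

(* The sigma-algebra generated by s_0, a_0, ..., s_t, a_t. *)
Definition action_history s a (t : nat) : set (set Omega) :=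
  <<s [set E | (exists k B, [/\ (k <= t)%N, measurable B & E = s k @^-1` B]) \/
               (exists k C, [/\ (k <= t)%N, measurable C & E = a k @^-1` C])] >>.

(* Under P, the process s_0, a_0, s_1, a_1, ... is the one generated by the
   policy pi: s_0 has law init, pi (s_t) is the conditional law of a_t given
   s_0, a_0, ..., s_t, and trans (s_t, a_t) is the conditional law of s_(t+1)
   given s_0, a_0, ..., s_t, a_t. This determines the law of the process, and
   by the Ionescu-Tulcea theorem such a P exists for every pi when Omega is the
   space of trajectories and s, a are the coordinate processes. *)
Definition generated_by (init : probability S R)
    (trans : R.-pker (S * A)%type ~> S) (pi : R.-pker S ~> A)
    s a (P : probability Omega R) : Prop :=
  [/\ forall B, measurable B -> P (s 0%N @^-1` B) = init B,
      forall t H C, state_history s a t H -> measurable C ->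
        P (H `&` a t @^-1` C) = (\int[P]_(omega in H) pi (s t omega) C)%E &
      forall t H B, action_history s a t H -> measurable B ->
        P (H `&` s t.+1 @^-1` B) =
        (\int[P]_(omega in H) trans (s t omega, a t omega) B)%E].

Context {d : nat}.
Implicit Types (gamma : R) (phi : S -> A -> 'cV[R]_d).

Definition discounted_terms gamma phi s a (i : 'I_d) (omega : Omega) : R^nat :=
  fun t => gamma ^+ t * phi (s t omega) (a t omega) i 0.

Definition discounted_features gamma phi s a (i : 'I_d) (omega : Omega) : R :=
  limn (series (discounted_terms gamma phi s a i omega)).

(* The series of discounted features converges almost surely and has an
   expectation in R^d. It is automatic for bounded measurable phi when
   0 <= gamma < 1. *)
Definition has_expected_features gamma phi s a (P : probability Omega R) :=
  forall i : 'I_d,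
    {ae P, forall omega, cvgn (series (discounted_terms gamma phi s a i omega))}
    /\ P.-integrable setT (EFin \o discounted_features gamma phi s a i).

Definition expected_features gamma phi s a (P : probability Omega R) :
    'cV[R]_d :=
  \col_i fine ('E_P[discounted_features gamma phi s a i])%E.

End MDP.

(* Main.v *)
(* Write mu piE - mu piL = p + k with k in ker Mbar and p orthogonal to it.
   Then |<w, p>| <= |p| <= |Mbar p| / sigma = |Mbar (p + k)| / sigma
   < eps / sigma, and |<w, k>| <= rho |k| <= rho |p + k| <= rho diam.
   No compactness is needed for sigma > 0: on the orthogonal complement of the
   kernel, a pseudo-inverse of Mbar gives a bound |v| <= C |Mbar v|. *)
Require Import Defs.
From HB Require Import structures.
From mathcomp Require Import all_boot all_order all_algebra.
From mathcomp Require Import all_classical all_reals all_analysis.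
From mathcomp Require Import ring.

Set Implicit Arguments.
Unset Strict Implicit.
Unset Printing Implicit Defensive.

Import Order.TTheory GRing.Theory Num.Theory.
Import numFieldNormedType.Exports.

Local Open Scope classical_set_scope.
Local Open Scope ring_scope.

Section Euclidean_space.
Context {R : realType}.

(** * Inner product and Euclidean norm *)

Lemma dotE n (u v : 'cV[R]_n) : dot u v = (u^T *m v) 0 0.
Proof. by rewrite mxE; apply: eq_bigr => i _; rewrite mxE. Qed.

Lemma dotC n (u v : 'cV[R]_n) : dot u v = dot v u.
Proof. by apply: eq_bigr => i _; rewrite mulrC. Qed.

Lemma dotDr n (u v v' : 'cV[R]_n) : dot u (v + v') = dot u v + dot u v'.
Proof. by rewrite !dotE mulmxDr mxE. Qed.

Lemma dotZr n c (u v : 'cV[R]_n) : dot u (c *: v) = c * dot u v.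
Proof. by rewrite !dotE -scalemxAr mxE. Qed.

Lemma dotDl n (u u' v : 'cV[R]_n) : dot (u + u') v = dot u v + dot u' v.
Proof. by rewrite dotC dotDr !(dotC v). Qed.

Lemma dotZl n c (u v : 'cV[R]_n) : dot (c *: u) v = c * dot u v.
Proof. by rewrite dotC dotZr dotC. Qed.

Lemma dot0r n (u : 'cV[R]_n) : dot u 0 = 0.
Proof. by rewrite dotE mulmx0 mxE. Qed.

Lemma dot_mulmxr m n (u : 'cV[R]_m) (M : 'M[R]_(m, n)) (v : 'cV[R]_n) :
  dot u (M *m v) = dot (M^T *m u) v.
Proof. by rewrite !dotE trmx_mul trmxK mulmxA. Qed.

Lemma dot_ge0 n (u : 'cV[R]_n) : 0 <= dot u u.
Proof. by apply: sumr_ge0 => i _; rewrite -expr2 sqr_ge0. Qed.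

Lemma dot_eq0 n (u : 'cV[R]_n) : (dot u u == 0) = (u == 0).
Proof.
apply/eqP/eqP => [u0|->]; last by rewrite dot0r.
apply/colP => i; rewrite mxE; apply/eqP; rewrite -sqrf_eq0 expr2; apply/eqP.
by apply: (psumr_eq0P _ u0) => // j _; rewrite -expr2 sqr_ge0.
Qed.

Lemma enorm_ge0 n (u : 'cV[R]_n) : 0 <= enorm u.
Proof. exact: sqrtr_ge0. Qed.

Lemma enorm_sqr n (u : 'cV[R]_n) : enorm u ^+ 2 = dot u u.
Proof. by rewrite sqr_sqrtr ?dot_ge0. Qed.

Lemma enorm_eq0 n (u : 'cV[R]_n) : (enorm u == 0) = (u == 0).
Proof. by rewrite -sqrf_eq0 enorm_sqr dot_eq0. Qed.

Lemma enormZ n c (u : 'cV[R]_n) : enorm (c *: u) = `|c| * enorm u.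
Proof.
by rewrite /enorm dotZl dotZr mulrA -expr2 sqrtrM ?sqr_ge0// sqrtr_sqr.
Qed.

Lemma enorm_normalize n (u : 'cV[R]_n) :
  u != 0 -> enorm ((enorm u)^-1 *: u) = 1.
Proof.
move=> u0; rewrite enormZ ger0_norm ?invr_ge0 ?enorm_ge0//.
by rewrite mulVf ?enorm_eq0.
Qed.

(** Cauchy-Schwarz: the squared norm of [<v,v> u - <u,v> v] is nonnegative and factors as [<v,v>]
    times the difference of the two sides. *)
Lemma sqr_dot_le n (u v : 'cV[R]_n) : dot u v ^+ 2 <= dot u u * dot v v.
Proof.
have [->|v0] := eqVneq v 0; first by rewrite !dot0r expr0n mulr0.
have vv : 0 < dot v v by rewrite lt_def dot_eq0 v0 dot_ge0.
have := dot_ge0 (dot v v *: u + - dot u v *: v).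
rewrite !(dotDl, dotDr, dotZl, dotZr) (dotC v u) => h.
rewrite -subr_ge0 -(pmulr_rge0 _ vv).
by apply: le_trans h _; rewrite le_eqVlt; apply/orP; left; apply/eqP; ring.
Qed.

Lemma norm_dot_le n (u v : 'cV[R]_n) : `|dot u v| <= enorm u * enorm v.
Proof.
rewrite -(@ler_pXn2r _ 2)// ?nnegrE ?mulr_ge0 ?enorm_ge0//.
by rewrite real_normK ?num_real// exprMn !enorm_sqr sqr_dot_le.
Qed.

(** * Bounds for linear maps and the orthogonal complement of the kernel *)

Lemma enorm_mulmx_bound m n (B : 'M[R]_(m, n)) :
  exists2 C : R, 0 < C & forall v, enorm (B *m v) <= C * enorm v.
Proof.
(* [F] is the squared Frobenius norm; Cauchy-Schwarz is applied row by row. Adding 1 to its root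
   keeps the constant invertible even when [B] is zero. *)
pose F := \sum_i dot (row i B)^T (row i B)^T.
have F0 : 0 <= F by apply: sumr_ge0 => i _; exact: dot_ge0.
exists (Num.sqrt F + 1) => [|v]; first by rewrite ltr_wpDl ?sqrtr_ge0.
apply: (@le_trans _ _ (Num.sqrt F * enorm v)); last first.
  by rewrite ler_wpM2r ?enorm_ge0// lerDl.
rewrite -(@ler_pXn2r _ 2)// ?nnegrE ?mulr_ge0 ?sqrtr_ge0 ?enorm_ge0//.
rewrite exprMn (sqr_sqrtr F0) !enorm_sqr mulr_suml; apply: ler_sum => i _.
suff -> : (B *m v) i 0 = dot (row i B)^T v by rewrite -expr2 sqr_dot_le.
by rewrite dotE trmxK -row_mul [RHS]mxE.
Qed.

(** The row space of [M] and the kernel, both seen as spaces of row vectors, meet trivially and have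
    ranks adding up to [n], so they span everything. *)
Lemma orthogonal_decomposition m n (M : 'M[R]_(m, n)) (x : 'cV[R]_n) :
  exists y : 'cV[R]_m, ker M (x - M^T *m y).
Proof.
(* If [u = y M] and [u M^T = 0], then [u u^T = y M M^T y^T = 0], hence [u = 0]. *)
have dir : (M :&: kermx M^T)%MS = 0.
  apply/eqP; rewrite -submx0; apply/rV_subP => u; rewrite sub_capmx.
  case/andP => /submxP[y ->] /sub_kermxP yMM; rewrite submx0.
  rewrite -trmx_eq0 -dot_eq0 dotE trmxK trmx_mul mulmxA yMM mul0mx mxE//.
have full : row_full (M + kermx M^T)%MS.
  by rewrite /row_full mxrank_disjoint_sum// mxrank_ker mxrank_tr
    subnKC// rank_leq_col.
have /sub_addsmxP[[y k] /= xE] := submx_full x^T full.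
exists y^T; have -> : x - M^T *m y^T = (k *m kermx M^T)^T.
  by rewrite -[x]trmxK xE -trmx_mul [in LHS]linearD/= addrAC subrr add0r.
by rewrite /ker/= -{1}[M]trmxK -trmx_mul -mulmxA mulmx_ker mulmx0 trmx0.
Qed.

Lemma dot_ker m n (M : 'M[R]_(m, n)) (y : 'cV[R]_m) u :
  ker M u -> dot u (M^T *m y) = 0.
Proof. by move=> Mu; rewrite dot_mulmxr trmxK Mu dotC dot0r. Qed.

Lemma enorm_mulmx_ge m n (M : 'M[R]_(m, n)) : exists2 c : R, 0 < c &
  forall v, (forall u, ker M u -> dot u v = 0) -> c * enorm v <= enorm (M *m v).
Proof.
have [C C0 hC] := enorm_mulmx_bound (pinvmx M)^T.
exists C^-1 => [|v vK]; first by rewrite invr_gt0.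
have [->|v0] := eqVneq v 0; first by rewrite /enorm mulmx0 !dot0r sqrtr0 mulr0.
(* The kernel component [v - M^T y] is orthogonal to both [v] and [M^T y], hence to itself. *)
have vM : (v^T <= M)%MS.
  have [y ky] := orthogonal_decomposition M v.
  suff /eqP : v - M^T *m y = 0.
    by rewrite subr_eq0 => /eqP ->; rewrite trmx_mul trmxK submxMl.
  apply/eqP; rewrite -dot_eq0 dotDr vK// add0r.
  by rewrite -[X in dot _ X]mulmxN dot_ker.
have vE : v = M^T *m ((pinvmx M)^T *m v).
  by rewrite -[LHS]trmxK -{1}(mulmxKpV vM) !trmx_mul trmxK.
have nv : 0 < enorm v by rewrite lt_def enorm_eq0 v0 enorm_ge0.
(* With [B] the transposed pseudo-inverse, [|v|^2 = <M^T B v, v> = <B v, M v> <= C |v| |M v|]. *)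
rewrite ler_pdivrMl// -(ler_pM2r nv) -expr2 enorm_sqr {1}vE -dot_mulmxr.
apply: le_trans (ler_norm _) _; apply: le_trans (norm_dot_le _ _) _.
rewrite mulrAC ler_wpM2r ?enorm_ge0//.
Qed.

(** * The constants [sigma] and [rho] *)

Lemma sigma_gt0 m n (M : 'M[R]_(m, n)) : M != 0 -> 0 < sigma M.
Proof.
move=> /eqP M0; have [c c0 hc] := enorm_mulmx_ge M.
apply: (lt_le_trans c0); apply: lb_le_inf => [|_ [v [vK v1] <-]]; last first.
  by have := hc _ vK; rewrite v1 mulr1.
(* The infimum of the empty set is 0 by convention, so a unit vector orthogonal to the kernel must
   be exhibited: a normalized nonzero row, which is [M^T] applied to a basis vector. *)
have [i ri] : exists i, row i M != 0.
  apply/existsP; rewrite -negb_forall; apply/negP => /forallP M_0; apply: M0.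
  by apply/row_matrixP => i; rewrite row0; exact/eqP.
pose v := (row i M)^T; have v0 : v != 0 by rewrite trmx_eq0.
eexists; exists ((enorm v)^-1 *: v) => //; split; last exact: enorm_normalize.
by move=> u ku; rewrite dotZr /v rowE trmx_mul dot_ker// mulr0.
Qed.

Lemma sigma_le m n (M : 'M[R]_(m, n)) v :
  (forall u, ker M u -> dot u v = 0) -> sigma M * enorm v <= enorm (M *m v).
Proof.
move=> vK; have [->|v0] := eqVneq v 0.
  by rewrite /enorm mulmx0 !dot0r sqrtr0 mulr0.
have nv : 0 < enorm v by rewrite lt_def enorm_eq0 v0 enorm_ge0.
rewrite -ler_pdivlMr// mulrC -{1}(ger0_norm (ltW nv)) -normfV -enormZ scalemxAr.
apply: ge_inf; first by exists 0 => _ [u _ <-]; exact: enorm_ge0.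
exists ((enorm v)^-1 *: v) => //; split; last exact: enorm_normalize.
by move=> u ku; rewrite dotZr vK// mulr0.
Qed.

Lemma ker_scale m n (M : 'M[R]_(m, n)) c v : ker M v -> ker M (c *: v).
Proof. by rewrite /ker /= -scalemxAr => ->; rewrite scaler0. Qed.

Lemma dot_le_rho m n (M : 'M[R]_(m, n)) (w v : 'cV[R]_n) :
  ker M v -> enorm v = 1 -> dot w v <= rho M w.
Proof.
move=> kv v1; rewrite /rho; case: asboolP => [k0|_].
  suff -> : v = 0 by rewrite dot0r.
  by rewrite k0 in kv.
apply: ub_le_sup; last by exists v.
(* By Cauchy-Schwarz the set under the supremum is bounded by [enorm w]. *)
exists (enorm w) => _ [u [_ u1] <-].
by apply: le_trans (ler_norm _) _; rewrite -[leRHS]mulr1 -u1 norm_dot_le.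
Qed.

Lemma norm_dot_ker_le m n (M : 'M[R]_(m, n)) (w v : 'cV[R]_n) :
  ker M v -> `|dot w v| <= rho M w * enorm v.
Proof.
move=> kv; have [->|v0] := eqVneq v 0.
  by rewrite /enorm !dot0r sqrtr0 mulr0 normr0.
have nv : 0 < enorm v by rewrite lt_def enorm_eq0 v0 enorm_ge0.
have n1 := enorm_normalize v0.
have kn := ker_scale (enorm v)^-1 kv.
rewrite ler_norml -mulNr; apply/andP; split.
(* The lower bound uses the opposite unit vector, which is also in the kernel. *)
- rewrite -ler_pdivlMr// lerNl mulrC.
  have := dot_le_rho w (ker_scale (-1) kn).
  by rewrite enormZ normrN1 mul1r !dotZr mulN1r => /(_ n1).
- by rewrite -ler_pdivrMr// mulrC -dotZr dot_le_rho.
Qed.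

Lemma rho_ge0 m n (M : 'M[R]_(m, n)) (w : 'cV[R]_n) : 0 <= rho M w.
Proof.
have [k0|] := pselect (ker M = [set 0]).
  by rewrite /rho; case: asboolP.
move=> k0; have [v kv v0] : exists2 v, ker M v & v != 0.
  apply: contrapT => h; apply: k0; apply/seteqP; split => [v kv|_ ->];
    last first.
    by rewrite /ker /= mulmx0.
  by apply: contrapT => /eqP v0; apply: h; exists v.
have nv : 0 < enorm v by rewrite lt_def enorm_eq0 v0 enorm_ge0.
(* [rho M w * |v|] dominates an absolute value, and [|v|] is positive. *)
rewrite -(pmulr_lge0 _ nv); exact: le_trans (norm_dot_ker_le w kv).
Qed.

(** * Stacked vectors and the bound for a single difference *)

Lemma enorm_mxcol_lt N (p : 'I_N -> nat) (u : forall i, 'cV[R]_(p i))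
    (eps : R) :
  (0 < N)%N -> (forall i, enorm (u i) < eps / N%:R) ->
  enorm (\mxcol_i u i) < eps.
Proof.
move=> N0 hu; have N0' : 0 < N%:R :> R by rewrite ltr0n.
have e0 : 0 < eps / N%:R.
  exact: le_lt_trans (enorm_ge0 _) (hu (Ordinal N0)).
have eps0 : 0 < eps by rewrite -(pmulr_lgt0 _ (_ : 0 < N%:R^-1)) ?invr_gt0.
rewrite -(@ltr_pXn2r _ 2)// ?nnegrE ?enorm_ge0 ?(ltW eps0)//.
rewrite enorm_sqr dotE tr_mxcol mul_mxrow_mxcol summxE.
(* The squared norm is the sum over the blocks, and [N (eps / N)^2 = eps^2 / N <= eps^2]. The sum is
   strictly smaller because [N > 0]. *)
apply: (@lt_le_trans _ _ (\sum_(i < N) (eps / N%:R) ^+ 2)).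
  apply: ltr_sum => [|i _]; first
    by apply/hasP; exists (Ordinal N0); rewrite ?mem_index_enum.
  by rewrite -dotE -enorm_sqr ltr_pXn2r// nnegrE ?enorm_ge0// ltW.
rewrite sumr_const card_ord exprMn -[leLHS]mulr_natr -[leLHS]mulrA.
rewrite ler_piMr ?sqr_ge0// expr2 -mulrA mulVf ?gt_eqF//.
by rewrite mulr1 invf_le1// ler1n.
Qed.

Lemma enorm_le_ediam n (X : set 'cV[R]_n) x y :
  X x -> X y -> ((enorm (x - y))%:E <= ediam X)%E.
Proof. by move=> Xx Xy; apply: ereal_sup_ubound; exists x => //; exists y. Qed.

(** The first claim for one vector [x], with [enorm x] in place of the diameter, so that everything
    stays in [R]. *)
Lemma norm_dot_lt m n (M : 'M[R]_(m, n)) (w x : 'cV[R]_n) (eps : R) :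
  M != 0 -> enorm w <= 1 -> enorm (M *m x) < eps ->
  `|dot w x| < eps / sigma M + rho M w * enorm x.
Proof.
move=> M0 w1 xeps; have s0 := sigma_gt0 M0.
have [y ky] := orthogonal_decomposition M x.
have pK u : ker M u -> dot u (M^T *m y) = 0 by exact: dot_ker.
move: (M^T *m y) (subrKC (M^T *m y) x) ky pK => p.
move: (x - p) => k /esym xE kK pK.
have Mp : M *m p = M *m x by rewrite xE mulmxDr kK addr0.
(* Pythagoras: [|x|^2 = |p|^2 + |k|^2]. *)
have kx : enorm k <= enorm x.
  rewrite ler_sqrt ?dot_ge0// xE dotDl !dotDr (dotC p k) (pK k kK) addr0 add0r.
  by rewrite lerDr dot_ge0.
rewrite xE dotDr -xE; apply: le_lt_trans (ler_normD _ _) _; apply: ltr_leD.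
- rewrite ltr_pdivlMr// mulrC; apply: le_lt_trans xeps; rewrite -Mp.
  apply: le_trans (sigma_le pK).
  rewrite ler_pM2l//; apply: le_trans (norm_dot_le _ _) _.
  by rewrite ler_piMl ?enorm_ge0.
- apply: le_trans (norm_dot_ker_le w kK) _.
  by rewrite ler_wpM2l ?rho_ge0.
Qed.

Lemma mulmx_stack n (V : finType) (dV : V -> nat)
    (M : forall nu : V, 'M[R]_(dV nu, n)) (x : 'cV[R]_n) :
  stack M *m x = \mxcol_k (M (enum_val k) *m x).
Proof. by rewrite /stack mxcol_mul. Qed.

End Euclidean_space.

Theorem theorem1 (R : realType) (dO dS dA : measure_display)
    (Omega : measurableType dO)
    (S : measurableType dS) (A : measurableType dA)
    (init : probability S R) (trans : R.-pker (S * A)%type ~> S)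
    (gamma : R) (hgamma : 0 <= gamma < 1)
    (d : nat) (phi : S -> A -> 'cV[R]_d)
    (s : nat -> {mfun Omega >-> S}) (a : nat -> {mfun Omega >-> A})
    (Pr : (R.-pker S ~> A) -> probability Omega R)
    (hPr : forall pi, generated_by init trans pi s a (Pr pi))
    (Pi : set (R.-pker S ~> A))
    (hmu : forall pi, Pi pi -> has_expected_features gamma phi s a (Pr pi))
    (w : 'cV[R]_d) (hw : enorm w <= 1)
    (r : S -> A -> R) (hr : forall x y, r x y = dot w (phi x y))
    (V : finType) (dV : V -> nat) (M : forall nu : V, 'M[R]_(dV nu, d))
    (piE piL : R.-pker S ~> A) (hE : Pi piE) (hL : Pi piL) :
  let mu := fun pi => expected_features gamma phi s a (Pr pi) in
  let Mbar := stack M in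
  (forall eps : R, Mbar != 0 ->
     (forall nu, enorm (M nu *m (mu piE - mu piL)) < eps / #|V|%:R) ->
     (`|dot w (mu piE - mu piL)|%:E <
        (eps / sigma Mbar)%:E + (rho Mbar w)%:E * ediam (mu @` Pi))%E)
  /\
  (\rank Mbar = d ->
     (forall nu, M nu *m mu piL = M nu *m mu piE) ->
     `|dot w (mu piE - mu piL)| = 0).
Proof.
move=> mu Mbar; split=> [eps M0 hM|rk hM].
(* Without perspectives [Mbar] would have no rows and so be zero. *)
- have V0 : (0 < #|V|)%N.
    rewrite lt0n; apply: contraNneq M0 => V0; apply/eqP.
    rewrite -[RHS]mxcol0; apply/eq_mxcol => -[k kV].
    by exfalso; move: kV; rewrite V0.
  have Mx : enorm (Mbar *m (mu piE - mu piL)) < eps.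
    by rewrite mulmx_stack; exact: enorm_mxcol_lt.
  (* Strictness is settled in [R]; the possibly infinite diameter enters only through a weak
     inequality, monotone since [rho] is nonnegative. *)
  apply: (@lt_le_trans _ _ (eps / sigma Mbar +
    rho Mbar w * enorm (mu piE - mu piL))%:E).
    by rewrite lte_fin norm_dot_lt.
  rewrite EFinD; apply: leeD2l; rewrite EFinM; apply: lee_wpmul2l;
    rewrite ?lee_fin ?rho_ge0//.
  by apply: enorm_le_ediam; [exists piE|exists piL].
- have Mx : Mbar *m (mu piE - mu piL) = Mbar *m 0.
    rewrite mulmx_stack mulmx0 -[RHS]mxcol0; apply/eq_mxcol => k.
    by rewrite mulmxBr hM subrr.
  (* Rank [d] makes multiplication by [Mbar] injective on column vectors, so the two feature
     expectations coincide. *)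
  have full : row_full Mbar by exact/eqP.
  by rewrite (row_full_inj full Mx) dot0r normr0.
Qed.
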